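(* Let $G$ be a torsion-free abelian group and let $A$ be a $G$-graded domain. If the polynomial ring $A[X_1,\dots,X_n]$ is a graded perinormal domain with the natural $G\times\mathbb{Z}_{\geq0}^n$-grading, then $A$ is a graded perinormal domain.
   Context: A $G$-graded domain is an integral domain $R=\bigoplus_{\alpha\in G}R_\alpha$ with each $R_\alpha$ an additive subgroup and $R_\beta R_\gamma\subseteq R_{\beta+\gamma}$. The natural $G\times\mathbb{Z}_{\ge0}^n$-grading on $A[X_1,\dots,X_n]$ has degree $(g,z_1,\dots,z_n)$ component $A_gX_1^{z_1}\cdots X_n^{z_n}$ (and is regarded as a $G\times\mathbb{Z}^n$-grading with zero components in the remaining degrees). The graded quotient field of a graded domain $R$ is $R_H$, where $H$ is the set of nonzero homogeneous elements; $f/g$ (with $f,g$ homogeneous, $g\neq0$) has degree $\deg f-\deg g$. A graded overring of $R$ is a graded subring of $R_H$ containing $R$. $h\text{-Spec}$ denotes the set of graded (homogeneous) prime ideals. A graded maximal ideal is an ideal maximal among proper graded ideals; a graded domain is gr-local if it has exactly one graded maximal ideal. A graded overring $S$ of $R$ satisfies gGD (graded going-down) if whenever $P,Q\in h\text{-Spec}(R)$ and $\tilde Q\in h\text{-Spec}(S)$ with $P\subseteq Q$ and $\tilde Q\cap R=Q$, there exists $\tilde P\in h\text{-Spec}(S)$ with $\tilde P\subseteq\tilde Q$ and $\tilde P\cap R=P$. A graded domain $R$ is a graded perinormal domain if every gr-local graded overring of $R$ satisfying gGD over $R$ is a localization of $R$ (i.e. equals $R_W$ for some multiplicative subset $W$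 of $R$). *)

(* Defs.v *)
From mathcomp Require Import all_boot all_order all_algebra.
From mathcomp Require Export fraction mpoly.
From mathcomp Require Export boolp classical_sets.

Set Implicit Arguments.
Unset Strict Implicit.
Unset Printing Implicit Defensive.

Import GRing.Theory.
Local Open Scope classical_set_scope.
Local Open Scope ring_scope.

Definition torsion_free (G : zmodType) : Prop :=
  forall (g : G) (k : nat), (0 < k)%N -> g *+ k = 0 -> g = 0.

(** [S] is the internal direct sum of the subgroups [C g]: every element of [S]
    is a finite sum of elements of the [C g], every such sum is in [S], and
    finite sums over pairwise distinct degrees are independent. *)
Definition direct_sum (G : zmodType) (T : zmodType) (S : set T)
    (C : G -> set T) : Prop :=
  (forall x, S x <-> exists (s : seq G) (f : G -> T),
     [/\ uniq s, forall g, C g (f g) & x = \sum_(g <- s) f g]) /\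
  (forall (s : seq G) (f : G -> T), uniq s -> (forall g, C g (f g)) ->
     \sum_(g <- s) f g = 0 -> forall g, g \in s -> f g = 0).

(** [R] is a domain by its type; [Rg] is the family of homogeneous components. *)
Definition graded_domain (G : zmodType) (R : idomainType)
    (Rg : G -> set R) : Prop :=
  [/\ forall g, GRing.zmod_closed (mem (Rg g)),
      forall g h x y, Rg g x -> Rg h y -> Rg (g + h) (x * y) &
      direct_sum setT Rg].

(** The next four notions concern a subring [S] of an ambient ring [T],
    graded by the family [C g] of subgroups of [S]. *)
Definition graded_ideal (G : zmodType) (T : comNzRingType) (S : set T)
    (C : G -> set T) (I : set T) : Prop :=
  [/\ I `<=` S, GRing.zmod_closed (mem I),
      forall x y, S x -> I y -> I (x * y) &
      direct_sum I (fun g => I `&` C g)].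

Definition hSpec (G : zmodType) (T : comNzRingType) (S : set T)
    (C : G -> set T) : set (set T) :=
  [set P | [/\ graded_ideal S C P, P <> S &
     forall x y, S x -> S y -> P (x * y) -> P x \/ P y]].

Definition graded_maximal (G : zmodType) (T : comNzRingType) (S : set T)
    (C : G -> set T) (M : set T) : Prop :=
  [/\ graded_ideal S C M, M <> S &
      forall I, graded_ideal S C I -> I <> S -> M `<=` I -> I = M].

Definition gr_local (G : zmodType) (T : comNzRingType) (S : set T)
    (C : G -> set T) : Prop :=
  exists! M : set T, graded_maximal S C M.

(** [R_W], inside the fraction field of [R]. *)
Definition localization (R : idomainType) (W : set R) : set {fraction R} :=
  [set x | exists r w, W w /\ x = tofrac r / tofrac w].

(** [0] is excluded because [R_W] is meant to be a domain containing [R]. *)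
Definition multiplicative (R : idomainType) (W : set R) : Prop :=
  [/\ W 1, forall x y, W x -> W y -> W (x * y) & ~ W 0].

Definition homog_nonzero (G : zmodType) (R : idomainType)
    (Rg : G -> set R) : set R :=
  [set h | h != 0 /\ exists g, Rg g h].

Definition graded_quotient_field (G : zmodType) (R : idomainType)
    (Rg : G -> set R) : set {fraction R} :=
  localization (homog_nonzero Rg).

(** The degree [g] component of the graded quotient field. *)
Definition quotient_component (G : zmodType) (R : idomainType)
    (Rg : G -> set R) (g : G) : set {fraction R} :=
  [set x | exists a b r h,
     [/\ Rg a r, Rg b h, h != 0, g = a - b & x = tofrac r / tofrac h]].

Definition overring_component (G : zmodType) (R : idomainType)
    (Rg : G -> set R) (S : set {fraction R}) (g : G) : set {fraction R} :=
  S `&` quotient_component Rg g.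

Definition graded_overring (G : zmodType) (R : idomainType)
    (Rg : G -> set R) (S : set {fraction R}) : Prop :=
  [/\ GRing.subring_closed (mem S),
      forall r : R, S (tofrac r),
      S `<=` graded_quotient_field Rg &
      direct_sum S (overring_component Rg S)].

(** The contraction of an ideal [I] of [S] to [R] is [@tofrac R @^-1` I]. *)
Definition gGD (G : zmodType) (R : idomainType) (Rg : G -> set R)
    (S : set {fraction R}) : Prop :=
  forall (P Q : set R) (Qt : set {fraction R}),
    hSpec setT Rg P -> hSpec setT Rg Q ->
    hSpec S (overring_component Rg S) Qt ->
    P `<=` Q -> @tofrac R @^-1` Qt = Q ->
    exists Pt : set {fraction R},
      [/\ hSpec S (overring_component Rg S) Pt, Pt `<=` Qt &
          @tofrac R @^-1` Pt = P].

Definition graded_perinormal (G : zmodType) (R : idomainType)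
    (Rg : G -> set R) : Prop :=
  forall S : set {fraction R},
    graded_overring Rg S -> gr_local S (overring_component Rg S) ->
    gGD Rg S ->
    exists W : set R, multiplicative W /\ S = localization W.

(** The component of degree [(g, z)] is [A_g X^z] when all [z i] are
    nonnegative, and [0] otherwise. *)
Definition mpoly_grading (G : zmodType) (A : idomainType) (Ag : G -> set A)
    (n : nat) (d : G * {ffun 'I_n -> int}) : set {mpoly A[n]} :=
  [set p | p = 0 \/ exists (a : A) (m : 'X_{1..n}),
     [/\ Ag d.1 a, forall i, d.2 i = (m i)%:Z & p = a *: 'X_[m]]].

Section MpolyGraded.
Local Notation mdeg_int m := [ffun i => (m i)%:Z].

Lemma direct_sum_addr (G T : zmodType) (C : G -> set T) (x y : T) :
  (forall g, GRing.zmod_closed (mem (C g))) ->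
  (exists (s : seq G) (f : G -> T),
     [/\ uniq s, forall g, C g (f g) & x = \sum_(g <- s) f g]) ->
  (exists (s : seq G) (f : G -> T),
     [/\ uniq s, forall g, C g (f g) & y = \sum_(g <- s) f g]) ->
  exists (s : seq G) (f : G -> T),
     [/\ uniq s, forall g, C g (f g) & x + y = \sum_(g <- s) f g].
Proof.
move=> zC [s [f [us Cf ->]]] [t [h [ut Ch ->]]].
have C0 g : C g 0 by have [/set_mem] := zC g.
have CD g u v : C g u -> C g v -> C g (u + v).
  move=> /mem_set uC /mem_set vC; have := GRing.zmod_closedD (zC g).
  by case=> _ /(_ u v uC vC) /set_mem.
exists (undup (s ++ t)).
exists (fun g => (if g \in s then f g else 0) + (if g \in t then h g else 0)).
split; [exact: undup_uniq|by move=> g; apply: CD; case: ifP|].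
rewrite big_split /=; congr (_ + _); rewrite -[RHS]big_mkcond -[RHS]big_filter;
  apply: perm_big; apply: uniq_perm; rewrite ?filter_uniq ?undup_uniq // => g;
  by rewrite mem_filter mem_undup mem_cat; case: (g \in s); case: (g \in t).
Qed.

(** The natural grading on the polynomial ring is indeed a grading. *)
Lemma mpoly_graded (G : zmodType) (A : idomainType) (Ag : G -> set A)
    (n : nat) :
  graded_domain Ag -> graded_domain (mpoly_grading Ag (n := n)).
Proof.
case=> zA mA [dA iA].
have A0 g : Ag g 0 by have [/set_mem] := zA g.
have AB g u v : Ag g u -> Ag g v -> Ag g (u - v).
  move=> /mem_set uC /mem_set vC; have [_ /(_ u v uC vC) /set_mem] := zA g.
  by [].
have E (m m' : 'X_{1..n}) (z : {ffun 'I_n -> int}) :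
    (forall i, z i = (m i)%:Z) -> (forall i, z i = (m' i)%:Z) -> m = m'.
  by move=> h h'; apply/mnmP => i; apply/eqP; rewrite -eqz_nat -h -h'.
have zM d : GRing.zmod_closed (mem (mpoly_grading Ag (n := n) d)).
  split=> [|u v /set_mem Cu /set_mem Cv]; apply/mem_set; first by left.
  case: Cu => [->|[a [m [Aa zm ->]]]].
    case: Cv => [->|[b [m [Ab zm ->]]]]; first by left; rewrite subr0.
    by right; exists (0 - b), m; split=> //; [exact: AB|rewrite !sub0r scaleNr].
  case: Cv => [->|[b [m' [Ab zm' ->]]]].
    by right; exists a, m; rewrite subr0.
  right; exists (a - b), m; rewrite (E _ _ _ zm' zm) scalerBl.
  by split=> //; apply: AB.
split=> //.
  move=> [g z] [h w] x y [->|[a [m [Aa zm ->]]]]; first by left; rewrite mul0r.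
  move=> [->|[b [m' [Ab zm' ->]]]]; first by left; rewrite mulr0.
  right; exists (a * b), (m + m')%MM; split=> /=; first exact: mA.
    by move=> i; rewrite ffunE zm zm' mnmDE PoszD.
  by rewrite mpolyXD -scalerAl -scalerAr scalerA.
split=> [p|s f us Cf S0 [g z] gs].
  split=> // _.
  rewrite (mpolyE p); elim/big_ind: _ => [|x y|m _].
  - by exists [::], (fun=> 0); split=> // [d|]; [left|rewrite big_nil].
  - exact: (direct_sum_addr zM).
  have [s [f [us Af ->]]] := (dA p@_m).1 I.
  exists [seq (g, mdeg_int m) | g <- s].
  exists (fun d => if d.2 == mdeg_int m then f d.1 *: 'X_[m] else 0).
  split.
  - by rewrite map_inj_uniq // => g h [].
  - move=> d; case: eqP => [dm|_]; last by left.
    by right; exists (f d.1), m; split=> // i; rewrite dm ffunE.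
  - rewrite big_map /= scaler_suml; apply: eq_bigr => g _.
    by rewrite eqxx.
have [//|[a [m [Aa zm fgz]]]] := Cf (g, z).
have zE : z = mdeg_int m by apply/ffunP=> i; rewrite ffunE zm.
have cA h : Ag h (f (h, z))@_m.
  case: (Cf (h, z)) => [->|[b [m' [Ab zm' ->]]]]; first by rewrite mcoeff0.
  by rewrite mcoeffZ (E _ _ _ zm' zm) mcoeffX eqxx mulr1.
pose t := [seq d.1 | d <- s & d.2 == z].
have ut : uniq t.
  rewrite map_inj_in_uniq ?filter_uniq // => -[h w] [h' w'].
  by rewrite !mem_filter /= => /andP[/eqP-> _] /andP[/eqP-> _] ->.
have St : \sum_(h <- t) (f (h, z))@_m = 0.
  have := congr1 (mcoeff m) S0; rewrite raddf_sum mcoeff0 /= => S0m.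
  rewrite big_map big_filter -[RHS]S0m.
  rewrite [RHS](bigID (fun d : G * _ => d.2 == z)) /=.
  rewrite [X in _ = _ + X]big1 ?addr0.
    by apply: eq_bigr => -[h w] /= /eqP->.
  move=> [h w] /= wz; case: (Cf (h, w)) => [->|[b [m' [_ zm' ->]]]].
    by rewrite mcoeff0.
  rewrite mcoeffZ mcoeffX; case: eqP => [mE|_]; last by rewrite mulr0.
  case/eqP: wz; rewrite zE -mE; apply/ffunP=> i.
  by rewrite ffunE; apply: zm'.
have /(iA _ _ ut cA St) : g \in t.
  by apply/mapP; exists (g, z); rewrite // mem_filter eqxx.
by rewrite fgz mcoeffZ mcoeffX eqxx mulr1 => ->; rewrite scale0r.
Qed.

End MpolyGraded.

(* Main.v *)
From HB Require Import structures.
Require Import Defs.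
From mathcomp Require Import all_boot all_order all_algebra.
From mathcomp Require Import generic_quotient ring.
From mathcomp Require Import boolp classical_sets.

(** Write K = Frac A, B = A[X_1, ..., X_n] and L = Frac B, and let S in K be a
    gr-local graded overring of A with gGD over A.  The idea is to test the
    hypothesis on B against T = S[X_1, ..., X_n], seen inside L, and to read
    off a localization of A from the one that it gives.

    Everything rests on the multigrading being so fine that a graded ideal of
    a polynomial ring contains every term c X^m of each of its elements.
    Consequently a graded prime of R[X] is P + (X_i : i in V) for a graded
    prime P of R and a set V of variables: P and V are what the prime contains
    of R and of the variables ([hSpec_mpolyE]), and conversely all these ideals
    are graded primes ([extension_hSpec]).  This is used for R = A and R = S.

    - T is gr-local.  A proper graded ideal of T has constant terms forming a
      proper graded ideal of S, hence contained in the graded maximal ideal M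
      of S; so M + (X_1, ..., X_n) contains every proper graded ideal of T
      ([gr_local_mpoly]).
    - T has gGD over B.  If P = P0 + (X_i : i in V) is contained in Q and N
      lies over Q, then going down for S, applied to P0 and to the constants of
      Q and N, gives a graded prime M0 of S contained in N and lying over P0, and
      M0 + (X_i : i in V) answers the question ([mpoly_overring_gGD]).
    - So T = B_W.  An element of W is a unit of the polynomial ring K[X],
      hence a constant, and comparing constants in S[X] = B_W gives
      S = A_(W meet A) ([mpoly_overring_localization]).

    To place S[X] inside L, one extends the inclusion of B to an injective ring
    morphism from K[X] to L ([mpoly_fraction_morphism]); graded ideals, graded
    primes and gr-locality are transported along it. *)

Set Implicit Arguments.
Unset Strict Implicit.
Unset Printing Implicit Defensive.

Import GRing.Theory.
Local Open Scope classical_set_scope.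
Local Open Scope ring_scope.

(** * Additive subgroups and subrings given as sets *)

Lemma zmod_setP (T : zmodType) (I : set T) :
  GRing.zmod_closed (mem I) <-> I 0 /\ (forall x y, I x -> I y -> I (x - y)).
Proof.
split=> [[/set_mem I0 IB]|[I0 IB]]; split=> //.
- by move=> x y /mem_set Ix /mem_set Iy; apply/set_mem/IB.
- exact/mem_set.
- by move=> x y /set_mem Ix /set_mem Iy; apply/mem_set/IB.
Qed.

Lemma zmod_setD (T : zmodType) (I : set T) x y :
  GRing.zmod_closed (mem I) -> I x -> I y -> I (x + y).
Proof.
move=> /zmod_setP[I0 IB] Ix Iy; rewrite -[y]opprK; apply: (IB _ _ Ix).
by rewrite -sub0r; apply: IB.
Qed.

Lemma zmod_set_sum (T : zmodType) (I : set T) (J : Type) (r : seq J)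
    (Q : pred J) (f : J -> T) :
  GRing.zmod_closed (mem I) -> (forall j, Q j -> I (f j)) ->
  I (\sum_(j <- r | Q j) f j).
Proof.
move=> zI If; elim/big_ind: _ => //; first by case/zmod_setP: zI.
by move=> x y; apply: zmod_setD.
Qed.

Lemma zmod_setI (T : zmodType) (I J : set T) :
  GRing.zmod_closed (mem I) -> GRing.zmod_closed (mem J) ->
  GRing.zmod_closed (mem (I `&` J)).
Proof.
move=> /zmod_setP[I0 IB] /zmod_setP[J0 JB]; apply/zmod_setP; split=> //.
by move=> x y [Ix Jx] [Iy Jy]; split; [exact: IB|exact: JB].
Qed.

Lemma zmod_set_image (T T' : zmodType) (f : {additive T -> T'}) (I : set T) :
  GRing.zmod_closed (mem I) -> GRing.zmod_closed (mem (f @` I)).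
Proof.
move=> /zmod_setP[I0 IB]; apply/zmod_setP; split.
  by exists 0; rewrite ?raddf0.
move=> _ _ [x Ix <-] [y Iy <-].
by exists (x - y); rewrite ?raddfB //; apply: IB.
Qed.

Lemma zmod_set_preimage (T T' : zmodType) (f : {additive T -> T'})
    (I : set T') :
  GRing.zmod_closed (mem I) -> GRing.zmod_closed (mem (f @^-1` I)).
Proof.
move=> /zmod_setP[I0 IB]; apply/zmod_setP; split=> /=.
  by rewrite /preimage /= raddf0.
by move=> x y /= Ix Iy; rewrite /preimage /= raddfB; apply: IB.
Qed.

Lemma subring_setP (T : nzRingType) (S : set T) :
  GRing.subring_closed (mem S) <->
  [/\ S 1, forall x y, S x -> S y -> S (x - y) &
      forall x y, S x -> S y -> S (x * y)].
Proof.
split=> [[/set_mem S1 SB SM]|[S1 SB SM]]; split=> //.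
- by move=> x y /mem_set Sx /mem_set Sy; apply/set_mem/SB.
- by move=> x y /mem_set Sx /mem_set Sy; apply/set_mem/SM.
- exact/mem_set.
- by move=> x y /set_mem Sx /set_mem Sy; apply/mem_set/SB.
- by move=> x y /set_mem Sx /set_mem Sy; apply/mem_set/SM.
Qed.

Lemma subring_zmod (T : nzRingType) (S : set T) :
  GRing.subring_closed (mem S) -> GRing.zmod_closed (mem S).
Proof. exact: GRing.subring_closedB. Qed.

(** * Sums of homogeneous elements *)

Definition homog_span (G : zmodType) (T : zmodType) (C : G -> set T) : set T :=
  [set x | exists (s : seq G) (f : G -> T),
     [/\ uniq s, forall g, C g (f g) & x = \sum_(g <- s) f g]].

Lemma homog_span_sub (G T : zmodType) (C D : G -> set T) :
  (forall g, C g `<=` D g) -> homog_span C `<=` homog_span D.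
Proof.
by move=> CD x [s [f [us Cf ->]]]; exists s, f; split=> // g; apply: CD.
Qed.

Lemma homog_span_homog (G T : zmodType) (C : G -> set T) g x :
  (forall g, GRing.zmod_closed (mem (C g))) -> C g x -> homog_span C x.
Proof.
move=> zC Cx; exists [:: g], (fun h => if h == g then x else 0); split=> //.
  by move=> h; case: eqP => [->//|_]; case/zmod_setP: (zC h).
by rewrite big_seq1 eqxx.
Qed.

Lemma homog_span_sum (G T : zmodType) (C : G -> set T) (J : Type)
    (r : seq J) (f : J -> T) :
  (forall g, GRing.zmod_closed (mem (C g))) ->
  (forall j, homog_span C (f j)) -> homog_span C (\sum_(j <- r) f j).
Proof.
move=> zC Cf; elim/big_ind: _ => //; last by move=> x y; apply: direct_sum_addr.
exists [::], (fun=> 0); split=> //; last by rewrite big_nil.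
by move=> g; case/zmod_setP: (zC g).
Qed.

Lemma homog_span_image (G T T' : zmodType) (f : {additive T -> T'})
    (C : G -> set T) :
  f @` homog_span C = homog_span (fun g => f @` C g).
Proof.
apply/seteqP; split=> [_ [_ [s [c [us Cc ->]]] <-]|_ [s [c [us Cc ->]]]].
  exists s, (f \o c); split=> [//|g|]; first by exists (c g).
  by rewrite raddf_sum.
have /choice[d dE] : forall g, exists x, C g x /\ f x = c g.
  by move=> g; have [x Cx <-] := Cc g; exists x.
exists (\sum_(g <- s) d g); first by exists s, d; split=> // g; have [] := dE g.
by rewrite raddf_sum; apply: eq_bigr => g _; have [] := dE g.
Qed.

Lemma direct_sum_image (G T T' : zmodType) (f : {additive T -> T'})
    (S : set T) (C : G -> set T) :
  injective f -> direct_sum S C -> direct_sum (f @` S) (fun g => f @` C g).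
Proof.
move=> injf [SE iC]; split=> [x|s c us Cc s0 g gs].
  have -> : S = homog_span C by apply/predeqP=> y; apply: SE.
  by rewrite homog_span_image.
have /choice[d dE] : forall g, exists x, C g x /\ f x = c g.
  by move=> h; have [x Cx <-] := Cc h; exists x.
have [Cd fd] : (forall h, C h (d h)) /\ (forall h, f (d h) = c h).
  by split=> h; have [] := dE h.
rewrite -fd (iC s d us Cd) ?raddf0 //; apply: injf; rewrite raddf_sum raddf0.
by rewrite -[RHS]s0; apply: eq_bigr.
Qed.

(** * Graded ideals of a graded subring *)

(** The common setting for A, for its overrings and for their polynomial
    rings. *)
Definition graded_subring (G : zmodType) (T : comNzRingType) (S : set T)
    (C : G -> set T) : Prop :=
  [/\ GRing.subring_closed (mem S), forall g, GRing.zmod_closed (mem (C g)) &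
      direct_sum S C].

Section GradedSubring.
Variables (G : zmodType) (T : comNzRingType) (S : set T) (C : G -> set T).
Hypothesis gS : graded_subring S C.

Lemma graded_subring_sub g : C g `<=` S.
Proof.
case: gS => _ zC [SE _] x Cx; apply/SE.
by apply: (homog_span_homog zC Cx).
Qed.

(** The components of an ideal inherit their independence from those of the
    ring, so that being graded only means that elements are sums of homogeneous
    elements of the ideal. *)
Lemma graded_idealP (I : set T) :
  graded_ideal S C I <->
  [/\ I `<=` S, GRing.zmod_closed (mem I),
      forall x y, S x -> I y -> I (x * y) &
      I `<=` homog_span (fun g => I `&` C g)].
Proof.
case: gS => [_ _ [_ iC]].
split=> [[IS zI mI [IE _]]|[IS zI mI IC]]; split=> //; first by move=> x /IE.
split=> [x|s f us Cf]; last by apply: iC => // g; have [] := Cf g.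
split=> [/IC//|[s [f [us Cf ->]]]].
by apply: zmod_set_sum => // g _; have [] := Cf g.
Qed.

Lemma graded_ideal_proper (I : set T) :
  graded_ideal S C I -> (I <> S <-> ~ I 1).
Proof.
case: gS => /subring_setP[S1 _ _] _ _ [IS _ mI _]; split=> [nI I1|nI1 IE].
  by apply: nI; apply/seteqP; split=> // x Sx; rewrite -[x]mulr1; apply: mI.
by apply: nI1; rewrite IE.
Qed.

Lemma homog_span_setI_zmod (I : set T) g :
  GRing.zmod_closed (mem I) -> GRing.zmod_closed (mem (I `&` C g)).
Proof. by case: gS => _ zC _ zI; apply: zmod_setI. Qed.

Lemma hSpec1 (P : set T) : hSpec S C P -> ~ P 1.
Proof. by case=> gP nP _; apply/(graded_ideal_proper gP). Qed.

(** Zorn's lemma puts a proper graded ideal inside a graded maximal one, and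
    there is only one of those. *)
Lemma gr_local_graded_maximal (M I : set T) :
  gr_local S C -> graded_maximal S C M -> graded_ideal S C I -> I <> S ->
  I `<=` M.
Proof.
case=> M' [_ uM'] maxM gI nI.
(* the empty set is admitted so that the empty chain has an upper bound *)
pose P X := X = set0 \/ [/\ graded_ideal S C X, X <> S & I `<=` X].
have [F FP totF|A [PA maxA]] := @Zorn_bigcup _ P.
  have [[X FX [x Xx]]|F0] := pselect (exists2 X, F X & X !=set0); last first.
    left; rewrite -subset0 => x [X FX Xx]; apply: F0.
    by exists X => //; exists x.
  right.
  have FE Y y : F Y -> Y y -> [/\ graded_ideal S C Y, Y <> S & I `<=` Y].
    by move=> /FP[->|].
  have gU : graded_ideal S C (\bigcup_(Y in F) Y).
    apply/graded_idealP; split.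
    - by move=> y [Y FY Yy]; have [[YS _ _ _] _ _] := FE _ _ FY Yy; apply: YS.
    - apply/zmod_setP; split.
        by exists X => //; have [[_ /zmod_setP[]]] := FE _ _ FX Xx.
      move=> y z [Y FY Yy] [Z FZ Zz].
      have [[_ /zmod_setP[_ YB] _ _] _ _] := FE _ _ FY Yy.
      have [[_ /zmod_setP[_ ZB] _ _] _ _] := FE _ _ FZ Zz.
      have [YZ|ZY] := totF _ _ FY FZ.
        by exists Z => //; apply: ZB => //; apply: YZ.
      by exists Y => //; apply: YB => //; apply: ZY.
    - move=> y z Sy [Z FZ Zz]; exists Z => //.
      by have [[_ _ mZ _] _ _] := FE _ _ FZ Zz; apply: mZ.
    - move=> y [Y FY Yy]; have [/graded_idealP[_ _ _ YC] _ _] := FE _ _ FY Yy.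
      apply: homog_span_sub (YC _ Yy) => g z [Yz Cz].
      by split=> //; exists Y.
  split=> //; last first.
    by move=> y Iy; exists X => //; have [_ _ IX] := FE _ _ FX Xx; apply: IX.
  apply/(graded_ideal_proper gU) => -[Y FY Y1].
  by have [gY nY _] := FE _ _ FY Y1; case: ((graded_ideal_proper gY).1 nY).
case: PA => [A0|[gA nA IA]].
  have I0 : I 0 by case: gI => _ /zmod_setP[].
  case: (maxA I); last by right; split.
  by rewrite A0; split=> // /(_ 0 I0).
have <- // : A = M.
rewrite -(uM' _ maxM); apply/esym/uM'; split=> // J gJ nJ AJ.
apply: contrapT => JA; apply: (maxA J).
  by split=> // JA'; apply: JA; exact/seteqP.
by right; split=> //; apply: subset_trans AJ.
Qed.

End GradedSubring.

(** * Transport along an injective ring morphism *)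

Section Transport.
Variables (G : zmodType) (T T' : comNzRingType) (f : {rmorphism T -> T'}).
Hypothesis injf : injective f.
Variables (S : set T) (C : G -> set T).
Hypothesis gS : graded_subring S C.

Lemma graded_subring_image : graded_subring (f @` S) (fun g => f @` C g).
Proof.
case: gS => /subring_setP[S1 SB SM] zC dS; split.
- apply/subring_setP; split; first by exists 1; rewrite ?rmorph1.
    move=> _ _ [x Sx <-] [y Sy <-].
    by exists (x - y); rewrite ?rmorphB //; apply: SB.
  move=> _ _ [x Sx <-] [y Sy <-].
  by exists (x * y); rewrite ?rmorphM //; apply: SM.
- by move=> g; apply: zmod_set_image.
- exact: direct_sum_image.
Qed.

Lemma image_fE (I : set T) x : (f @` I) (f x) = I x.
Proof. exact: image_inj. Qed.

Lemma image_eq (I J : set T) : f @` I = f @` J -> I = J.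
Proof.
by move=> IJ; apply/predeqP=> x; rewrite -(image_fE I) IJ image_fE.
Qed.

Lemma graded_ideal_image (I : set T) :
  graded_ideal (f @` S) (fun g => f @` C g) (f @` I) <-> graded_ideal S C I.
Proof.
have gS' := graded_subring_image.
have IC : homog_span (fun g => f @` I `&` f @` C g) =
          f @` homog_span (fun g => I `&` C g).
  rewrite homog_span_image; congr homog_span; apply/funext=> g.
  apply/seteqP; split=> [x [[y Iy <-] [z Cz /injf zy]]|_ [x [Ix Cx] <-]].
    by exists y => //; split=> //; rewrite -zy.
  by split; exists x.
split=> /graded_idealP -/(_ _) [//|IS zI mI Ic]; apply/graded_idealP => //.
- split.
  + by move=> x Ix; rewrite -image_fE; apply: IS; exists x.
  + have := zmod_set_preimage f zI; congr (GRing.zmod_closed (mem _)).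
    by apply/predeqP=> x; rewrite -[I x]image_fE.
  + move=> x y Sx Iy; rewrite -image_fE rmorphM.
    by apply: mI; [exists x|exists y].
  + move=> x Ix; rewrite -image_fE -IC.
    by apply: Ic; exists x.
- split.
  + by move=> _ [x Ix <-]; exists x => //; apply: IS.
  + exact: zmod_set_image.
  + move=> _ _ [x Sx <-] [y Iy <-]; exists (x * y); rewrite ?rmorphM //.
    exact: mI.
  + by rewrite IC; apply: image_subset.
Qed.

Lemma image_of_subset (J : set T') :
  J `<=` f @` S -> exists2 I : set T, I `<=` S & J = f @` I.
Proof.
move=> JS; exists (S `&` f @^-1` J); first by move=> x [].
apply/seteqP; split=> [y Jy|_ [x [_ Jx] <-] //].
by have [x Sx xy] := JS y Jy; exists x => //; split=> //=; rewrite xy.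
Qed.

Lemma hSpec_image (P : set T) :
  hSpec (f @` S) (fun g => f @` C g) (f @` P) <-> hSpec S C P.
Proof.
split=> -[gP nP pP]; split.
- exact/graded_ideal_image.
- by move=> PS; apply: nP; rewrite PS.
- move=> x y Sx Sy Pxy.
  rewrite -image_fE -[P y]image_fE.
  by apply: pP; [exists x|exists y|rewrite -rmorphM; exists (x * y)].
- exact/graded_ideal_image.
- by move/image_eq.
- move=> _ _ [x Sx <-] [y Sy <-]; rewrite -rmorphM !image_fE //.
  exact: pP.
Qed.

Lemma gr_local_image :
  gr_local S C -> gr_local (f @` S) (fun g => f @` C g).
Proof.
case=> M [maxM uM].
have maxI I : graded_maximal (f @` S) (fun g => f @` C g) (f @` I) <->
              graded_maximal S C I.
  split=> -[gI nI mI]; split.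
  - exact/graded_ideal_image.
  - by move=> IS; apply: nI; rewrite IS.
  - move=> J /graded_ideal_image gJ nJ IJ; apply: image_eq; apply: mI => //.
      by move/image_eq.
    exact: image_subset.
  - exact/graded_ideal_image.
  - by move/image_eq.
  - move=> J gJ nJ IJ; have [JS _ _ _] := gJ.
    have [K KS JK] := image_of_subset JS; rewrite JK in gJ nJ IJ *.
    congr image; apply: mI; first exact/graded_ideal_image.
      by move=> KE; apply: nJ; rewrite KE.
    by move=> x Ix; rewrite -image_fE; apply: IJ; exists x.
exists (f @` M); split=> [|N maxN]; first exact/maxI.
have [[NS _ _ _] _ _] := maxN.
have [K KS NK] := image_of_subset NS; rewrite NK in maxN *.
by congr image; apply: uM; apply/maxI.
Qed.

End Transport.

(** * Graded ideals of a polynomial ring *)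

(** The subring R[X_1, ..., X_n] of F[X_1, ..., X_n]. *)
Definition mpoly_over (F : idomainType) (R : set F) (n : nat) :
  set {mpoly F[n]} := [set p | forall m, R p@_m].
Arguments mpoly_over {F} R n _.

Section PolynomialGrading.
Variables (G : zmodType) (F : idomainType) (R : set F) (C : G -> set F).
Variable n : nat.
Hypothesis gR : graded_subring R C.

Local Notation D := (mpoly_grading C (n := n)).

Local Notation RX := (mpoly_over R n).

Let R0 : R 0. Proof. by case: gR => /subring_zmod/zmod_setP[]. Qed.
Let R1 : R 1. Proof. by case: gR => /subring_setP[]. Qed.
Let RM x y : R x -> R y -> R (x * y).
Proof. by case: gR => /subring_setP[_ _ SM] _ _; apply: SM. Qed.
Let zR : GRing.zmod_closed (mem R).
Proof. by case: gR => /subring_zmod. Qed.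
Let RC g : C g `<=` R. Proof. exact: (graded_subring_sub gR). Qed.
Let C0 g : C g 0. Proof. by case: gR => _ /(_ g)/zmod_setP[]. Qed.

Definition mdegZ (m : 'X_{1..n}) : {ffun 'I_n -> int} := [ffun i => (m i)%:Z].

Lemma mdegZ_inj : injective mdegZ.
Proof.
move=> m m' /ffunP mm'; apply/mnmP=> i; apply/eqP.
by have := mm' i; rewrite !ffunE => /eqP.
Qed.

Lemma mpoly_gradingP d p :
  D d p <-> p = 0 \/ exists c m, [/\ C d.1 c, d.2 = mdegZ m & p = c *: 'X_[m]].
Proof.
split=> -[->|[c [m [Cc dm ->]]]]; first by left.
- by right; exists c, m; split=> //; apply/ffunP=> i; rewrite ffunE dm.
- by left.
- by right; exists c, m; split=> // i; rewrite dm ffunE.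
Qed.

Lemma mpoly_grading_term g m c : C g c -> D (g, mdegZ m) (c *: 'X_[m]).
Proof. by move=> Cc; apply/mpoly_gradingP; right; exists c, m. Qed.

Lemma mcoeff_term c (m k : 'X_{1..n}) :
  (c *: 'X_[m] : {mpoly F[n]})@_k = if m == k then c else 0.
Proof. by rewrite mcoeffZ mcoeffX; case: eqP; rewrite ?mulr1 ?mulr0. Qed.

Lemma mpoly_grading_mcoeff d p m : D d p -> C d.1 p@_m.
Proof.
case/mpoly_gradingP=> [->|[c [k [Cc _ ->]]]]; first by rewrite mcoeff0.
by rewrite mcoeff_term; case: eqP.
Qed.

Lemma mpoly_grading_mcoeff_out d p m : D d p -> d.2 <> mdegZ m -> p@_m = 0.
Proof.
case/mpoly_gradingP=> [->|[c [k [_ -> ->]]]]; first by rewrite mcoeff0.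
by rewrite mcoeff_term; case: eqP => [->|].
Qed.

Lemma mpoly_grading_termE d p m : D d p -> d.2 = mdegZ m -> p = p@_m *: 'X_[m].
Proof.
case/mpoly_gradingP=> [->|[c [k [_ -> ->]]] /mdegZ_inj <-].
  by rewrite mcoeff0 scale0r.
by rewrite mcoeff_term eqxx.
Qed.

Lemma mpoly_grading_sub d : D d `<=` RX.
Proof. by move=> p Dp m; apply: RC; apply: mpoly_grading_mcoeff Dp. Qed.

Lemma mpoly_grading_zmod d : GRing.zmod_closed (mem (D d)).
Proof.
case: gR => _ /(_ d.1)/zmod_setP[_ CB] _; apply/zmod_setP.
split=> [|p q Dp Dq]; first by left.
have [[m dm]|Nd] := pselect (exists m, d.2 = mdegZ m).
  apply/mpoly_gradingP; right; exists (p - q)@_m, m; split=> //.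
    by rewrite mcoeffB; apply: CB; apply: mpoly_grading_mcoeff.
  rewrite mcoeffB scalerBl.
  by rewrite -(mpoly_grading_termE Dp dm) -(mpoly_grading_termE Dq dm).
have D0 r : D d r -> r = 0.
  move=> Dr; apply/mpolyP=> m; rewrite mcoeff0.
  by apply: (mpoly_grading_mcoeff_out Dr) => dm; apply: Nd; exists m.
by left; rewrite (D0 p) // (D0 q) // subr0.
Qed.

Lemma mpoly_over_subring : GRing.subring_closed (mem RX).
Proof.
apply/subring_setP; split.
- by move=> m; rewrite mcoeff1; case: eqP.
- move=> p q Rp Rq m; rewrite mcoeffB; case/zmod_setP: zR => _; apply.
    exact: Rp.
  exact: Rq.
- move=> p q Rp Rq m; rewrite mcoeffM; apply: zmod_set_sum => // k _.
  by apply: RM; [apply: Rp|apply: Rq].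
Qed.

(** A vanishing sum of homogeneous polynomials vanishes coefficientwise, and
    its coefficient at X^m only involves the degrees (h, m); independence thus
    reduces to that of the components of R. *)
Lemma mpoly_direct_sum : direct_sum RX D.
Proof.
case: gR => _ zC [RE iC]; split=> [p|s f us Df s0 [g z] ds]; last first.
  have [[m zm]|Nz] := pselect (exists m, z = mdegZ m); last first.
    apply/mpolyP=> m; rewrite mcoeff0.
    apply: (mpoly_grading_mcoeff_out (Df _)) => /= zm.
    by apply: Nz; exists m.
  rewrite (mpoly_grading_termE (Df (g, z)) zm).
  pose t := [seq d.1 | d <- s & d.2 == z].
  suff -> : (f (g, z))@_m = 0 by rewrite scale0r.
  apply: (iC t (fun h => (f (h, z))@_m)).
  - rewrite map_inj_in_uniq ?filter_uniq // => -[h w] [h' w'].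
    by rewrite !mem_filter /= => /andP[/eqP-> _] /andP[/eqP-> _] ->.
  - by move=> h; apply: (mpoly_grading_mcoeff m (Df (h, z))).
  - have := congr1 (mcoeff m) s0; rewrite raddf_sum mcoeff0 /= => s0m.
    rewrite -[RHS]s0m big_map big_filter big_mkcond.
    apply: eq_bigr => -[h w] _ /=.
    case: eqP => [->//|wz]; apply/esym.
    by apply: (mpoly_grading_mcoeff_out (Df (h, w))) => /=; rewrite -zm.
  - by apply/mapP; exists (g, z); rewrite // mem_filter eqxx.
split=> [Rp|[s [f [us Df ->]]] m]; last first.
  rewrite raddf_sum; apply: zmod_set_sum => // d _.
  by apply: RC; apply: mpoly_grading_mcoeff (Df d).
rewrite (mpolyE p).
apply: (homog_span_sum _ mpoly_grading_zmod) => m.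
have [s [f [us Cf ->]]] := (RE p@_m).1 (Rp m).
rewrite scaler_suml; apply: (homog_span_sum _ mpoly_grading_zmod) => g.
exact: (homog_span_homog mpoly_grading_zmod (mpoly_grading_term m (Cf g))).
Qed.

Lemma mpoly_graded_subring : graded_subring RX D.
Proof.
split; [exact: mpoly_over_subring|exact: mpoly_grading_zmod|].
exact: mpoly_direct_sum.
Qed.

Lemma mpoly_overC c : R c -> RX c%:MP.
Proof. by move=> Rc m; rewrite mcoeffC; apply: RM => //; case: eqP. Qed.

Lemma mpoly_overX m : RX 'X_[m].
Proof. by move=> k; rewrite mcoeffX; case: eqP. Qed.

(** The homogeneous components of p whose degree has exponent m add up to the
    term of p at X^m. *)
Lemma graded_ideal_term (P : set {mpoly F[n]}) p m :
  graded_ideal RX D P -> P p -> P (p@_m *: 'X_[m]).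
Proof.
case=> [_ zP _ [PE _]] /PE [s [f [us Pf ->]]].
rewrite raddf_sum scaler_suml; apply: zmod_set_sum => // d _.
have [Pfd Dfd] := Pf d.
have [dm|dm] := pselect (d.2 = mdegZ m).
  by rewrite /= -(mpoly_grading_termE Dfd dm).
rewrite /= (mpoly_grading_mcoeff_out Dfd dm) scale0r.
by case/zmod_setP: zP.
Qed.

Lemma contraction_graded_ideal (P : set {mpoly F[n]}) :
  graded_ideal RX D P -> graded_ideal R C (mpolyC n (R:=F) @^-1` P).
Proof.
move=> gP; have [PR zP mP [PE _]] := gP.
have zPC : GRing.zmod_closed (mem (mpolyC n (R:=F) @^-1` P)).
  exact: zmod_set_preimage.
apply/(graded_idealP gR); split=> //.
- by move=> c /PR/(_ 0%MM); rewrite mcoeffC eqxx mulr1.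
- move=> x y Rx Py; rewrite /preimage /= mpolyCM.
  exact: mP (mpoly_overC Rx) _.
- move=> c Pc; have [s [f [us Pf cE]]] := (PE _).1 Pc.
  have -> : c = \sum_(d <- s) (f d)@_0.
    by rewrite -raddf_sum -cE /= mcoeffC eqxx mulr1.
  have zPI g := homog_span_setI_zmod gR g zPC.
  apply: homog_span_sum => // d; have [Pfd Dfd] := Pf d.
  apply: (homog_span_homog (g := d.1)) => //; split; last first.
    exact: mpoly_grading_mcoeff Dfd.
  rewrite /preimage /= -[X in P X]mulr1 -mpolyX0 mul_mpolyC.
  exact: graded_ideal_term.
Qed.

Lemma contraction_hSpec (P : set {mpoly F[n]}) :
  hSpec RX D P -> hSpec R C (mpolyC n (R:=F) @^-1` P).
Proof.
move=> hP; have P1 := hSpec1 mpoly_graded_subring hP.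
have [gP _ pP] := hP; have gPC := contraction_graded_ideal gP.
split=> //.
  by apply/(graded_ideal_proper gR gPC); rewrite /preimage /= mpolyC1.
move=> x y Rx Ry; rewrite /preimage /= mpolyCM.
by apply: pP; apply: mpoly_overC.
Qed.

(** The monomials outside the ideal generated by the variables in V. *)
Definition avoids (V : set 'I_n) (m : 'X_{1..n}) : Prop :=
  forall i, V i -> m i = 0%N.

(** The ideal P + (X_i : i in V) of R[X], described by coefficients. *)
Definition monomial_extension (P : set F) (V : set 'I_n) : set {mpoly F[n]} :=
  [set p | RX p /\ forall m, avoids V m -> P p@_m].

Lemma avoidsD (V : set 'I_n) (m k : 'X_{1..n}) :
  avoids V (m + k)%MM <-> avoids V m /\ avoids V k.
Proof.
split=> [mk|[mV kV] i Vi]; last by rewrite mnmDE mV ?kV.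
by split=> i Vi; apply/eqP; have /eqP := mk i Vi;
  rewrite mnmDE addn_eq0 => /andP[].
Qed.

Lemma avoids0 (V : set 'I_n) : avoids V 0%MM.
Proof. by move=> i _; rewrite mnm0E. Qed.

Lemma extension_graded_ideal (P : set F) (V : set 'I_n) :
  graded_ideal R C P -> graded_ideal RX D (monomial_extension P V).
Proof.
move=> /(graded_idealP gR) [PR zP mP PC].
have /zmod_setP[P0 PB] := zP.
have zE : GRing.zmod_closed (mem (monomial_extension P V)).
  apply/zmod_setP; split.
    by split=> m *; rewrite mcoeff0.
  move=> p q [Rp Pp] [Rq Pq]; split=> m => [|mV]; rewrite mcoeffB.
    by case/zmod_setP: zR => _; apply.
  by apply: PB; [apply: Pp|apply: Pq].
apply/(graded_idealP mpoly_graded_subring); split=> //.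
- by move=> p [].
- move=> p q Rp [Rq Pq]; split.
    by case/subring_setP: mpoly_over_subring => _ _; apply.
  move=> m mV; rewrite mcoeffM; apply: zmod_set_sum => // k /eqP mk.
  apply: mP => //; apply: Pq.
  by have [] : avoids V k.1 /\ avoids V k.2 by apply/avoidsD; rewrite -mk.
- move=> p [Rp Pp]; rewrite (mpolyE p).
  have zED d := homog_span_setI_zmod mpoly_graded_subring d zE.
  apply: homog_span_sum => // m.
  have [mV|mV] := pselect (avoids V m).
    have [s [f [us Cf ->]]] := PC _ (Pp m mV).
    rewrite scaler_suml; apply: homog_span_sum => // g.
    have [Pfg Cfg] := Cf g.
    apply: (homog_span_homog (g := (g, mdegZ m))) => //; split; last first.
      exact: mpoly_grading_term.
    by split=> k => [|kV]; rewrite mcoeff_term; case: eqP => // _; apply: PR.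
  case: gR => _ _ [RE _]; have [s [f [us Cf ->]]] := (RE _).1 (Rp m).
  rewrite scaler_suml; apply: homog_span_sum => // g.
  apply: (homog_span_homog (g := (g, mdegZ m))) => //; split; last first.
    exact: mpoly_grading_term.
  split=> k => [|kV]; rewrite mcoeff_term; case: eqP => // mk.
    exact: RC (Cf g).
  by rewrite mk in mV.
Qed.

(** Modulo the extension, p and q may be replaced by the sums of their terms
    that lie outside it; if neither sum is zero, the product of the two leading
    coefficients shows that p q lies outside too. *)
Lemma extension_prime (P : set F) (V : set 'I_n) :
  graded_ideal R C P ->
  (forall x y, R x -> R y -> P (x * y) -> P x \/ P y) ->
  forall p q, RX p -> RX q -> monomial_extension P V (p * q) ->
    monomial_extension P V p \/ monomial_extension P V q.
Proof.
move=> gP pP; set E := monomial_extension P V.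
have [ER /zmod_setP[E0 EB] mE _] := extension_graded_ideal V gP.
have /zmod_setP[P0 _] : GRing.zmod_closed (mem P) by case: gP.
pose bad (p : {mpoly F[n]}) m := avoids V m /\ ~ P p@_m.
pose red p : {mpoly F[n]} :=
  \sum_(m <- msupp p) (if `[< bad p m >] then p@_m else 0) *: 'X_[m].
have redE p m : (red p)@_m = if `[< bad p m >] then p@_m else 0.
  rewrite raddf_sum /=; have [ms|ms] := boolP (m \in msupp p).
    rewrite (bigD1_seq m) ?msupp_uniq //= mcoeff_term eqxx big1 ?addr0 //.
    by move=> k /negPf km; rewrite mcoeff_term km.
  rewrite (memN_msupp_eq0 ms) if_same big_seq big1 // => k ks.
  by rewrite mcoeff_term; case: eqP => // km; rewrite -km ks in ms.
have Rred p : RX p -> RX (red p).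
  by move=> Rp m; rewrite redE; case: ifP.
have Ered p : RX p -> E (p - red p).
  move=> Rp; split=> m => [|mV]; rewrite mcoeffB redE; case: asboolP => bm;
    rewrite ?subrr ?subr0 //.
  by apply: contrapT => Pm; apply: bm.
have red0 p : RX p -> red p = 0 -> E p.
  by move=> Rp /= r0; have := Ered p Rp; rewrite r0 subr0.
have redP p : red p <> 0 -> bad p (mlead (red p)).
  move=> /eqP; rewrite -mleadc_eq0 redE; case: asboolP => // _.
  by rewrite eqxx.
move=> p q Rp Rq Epq.
have [/(red0 _ Rp)|/eqP rp] := eqVneq (red p) 0; first by left.
have [/(red0 _ Rq)|/eqP rq] := eqVneq (red q) 0; first by right.
(* red p * red q differs from p * q by an element of the ideal E *)
have {Epq}Er : E (red p * red q).
  have -> : red p * red q =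
      (p * q - q * (p - red p)) - (red p * (q - red q)).
    by ring.
  apply: (EB); last exact: mE (Rred _ Rp) (Ered _ Rq).
  by apply: (EB) => //; apply: mE (Rq) (Ered _ Rp).
have bp := redP p rp; have bq := redP q rq.
have [pV pN] := bp; have [qV qN] := bq.
have := Er.2 _ ((avoidsD _ _ _).2 (conj pV qV)); rewrite mleadcM !redE.
by rewrite (asboolT bp) (asboolT bq) => /(pP _ _ (Rp _) (Rq _))[].
Qed.

Lemma extension_hSpec (P : set F) (V : set 'I_n) :
  hSpec R C P -> hSpec RX D (monomial_extension P V).
Proof.
move=> hP; have P1 := hSpec1 gR hP; case: hP => gP _ pP.
have gE := extension_graded_ideal V gP.
split=> //; last exact: extension_prime.
apply/(graded_ideal_proper mpoly_graded_subring gE) => -[_ /(_ _ (@avoids0 V))].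
by rewrite mcoeff1 eqxx.
Qed.

Lemma prime_monomial (P : set {mpoly F[n]}) (m : 'X_{1..n}) :
  hSpec RX D P -> (P 'X_[m] <-> exists2 i, P 'X_i & m i <> 0%N).
Proof.
move=> hP; have P1 := hSpec1 mpoly_graded_subring hP.
have [[PR zP mP _] _ pP] := hP; split=> [|[i Pi mi]].
  apply: contraPP => Nm.
  suff [] : RX 'X_[m] /\ ~ P 'X_[m] by [].
  have [X1 _ XM] := (subring_setP RX).1 mpoly_over_subring.
  have NM x y : RX x /\ ~ P x -> RX y /\ ~ P y -> RX (x * y) /\ ~ P (x * y).
    by move=> [Rx Px] [Ry Py]; split; [exact: XM|case/(pP _ _ Rx Ry)].
  rewrite mpolyXE_id; elim/big_ind: _ => // i _.
  have [->|/eqP mi] := eqVneq (m i) 0%N; first by rewrite expr0.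
  have Ni : RX 'X_i /\ ~ P 'X_i.
    by split=> [|Pi]; [exact: mpoly_overX|apply: Nm; exists i].
  by elim: (m i) => [|k IH]; rewrite ?expr0 // exprS; apply: NM.
have -> : m = (m - U_(i) + U_(i))%MM.
  by rewrite submK //; apply/mnm_lepP=> j; rewrite mnm1E; case: eqP => // <-;
    rewrite lt0n; apply/eqP.
by rewrite mpolyXD; apply: mP; first exact: mpoly_overX.
Qed.

(** A graded prime contains the terms of its elements, and being prime it
    contains, with a term c X^m, either c or a variable dividing X^m. *)
Lemma hSpec_mpolyE (P : set {mpoly F[n]}) : hSpec RX D P ->
  P = monomial_extension (mpolyC n (R:=F) @^-1` P) [set i | P 'X_i].
Proof.
move=> hP; have [gP _ pP] := hP; have [PR zP mP _] := gP.
apply/seteqP; split=> p => [Pp|[Rp Pp]].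
  split; first exact: PR.
  move=> m mV; have := graded_ideal_term m gP Pp; rewrite -mul_mpolyC => Pm.
  have Rc : RX (p@_m)%:MP by apply: mpoly_overC; apply: PR.
  case: (pP _ _ Rc (mpoly_overX m) Pm) => // /(prime_monomial _ hP)[i Pi].
  by rewrite (mV i).
rewrite (mpolyE p); apply: zmod_set_sum => // m _.
have [mV|mV] := pselect (avoids [set i | P 'X_i] m).
  by rewrite -mul_mpolyC mulrC; apply: mP (mpoly_overX m) _; apply: Pp.
have /(prime_monomial _ hP) Pm : exists2 i, P 'X_i & m i <> 0%N.
  by apply: contrapT => Ne; apply: mV => i Pi; apply: contrapT => mi;
    apply: Ne; exists i.
by rewrite -mul_mpolyC; apply: mP => //; apply: mpoly_overC.
Qed.

(** Every variable belongs to the graded maximal ideal of R[X], which is why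
    it is the extension of M by all the variables: membership only depends on
    the constant term, and constants are controlled by M. *)
Lemma gr_local_mpoly : gr_local R C -> gr_local RX D.
Proof.
move=> lR; have [M [maxM _]] := lR; have [gM nM mM] := maxM.
have M1 := (graded_ideal_proper gR gM).1 nM.
have [MR zM _ _] := gM.
pose N := monomial_extension M setT.
have gN : graded_ideal RX D N by exact: extension_graded_ideal.
have avT m : avoids setT m -> m = 0%MM.
  by move=> mV; apply/mnmP=> i; rewrite mnm0E mV.
have N1 : ~ N 1 by case=> _ /(_ _ (@avoids0 _)); rewrite mcoeff1 eqxx.
have nN := (graded_ideal_proper mpoly_graded_subring gN).2 N1.
have subN I : graded_ideal RX D I -> I <> RX -> I `<=` N.
  move=> gI /(graded_ideal_proper mpoly_graded_subring gI) I1 p Ip.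
  have [IR _ _ _] := gI; split; first exact: IR.
  move=> m /avT->.
  have gIC := contraction_graded_ideal gI.
  have nIC : mpolyC n (R:=F) @^-1` I <> R.
    by apply/(graded_ideal_proper gR gIC); rewrite /preimage /= mpolyC1.
  apply: (gr_local_graded_maximal gR lR maxM gIC nIC).
  rewrite /preimage /= -[X in I X]mulr1 -mpolyX0 mul_mpolyC.
  exact: graded_ideal_term.
exists N; split.
  by split=> // I gI nI NI; apply/seteqP; split=> //; apply: subN.
by move=> I [gI nI mI]; apply: mI => //; apply: subN.
Qed.

End PolynomialGrading.

(** * Embedding polynomials over the fraction field *)

Lemma subf_div (F : fieldType) (a b c d : F) : b != 0 -> d != 0 ->
  a / b - c / d = (a * d - c * b) / (b * d).
Proof. by move=> b0 d0; rewrite -mulNr addf_div // mulNr. Qed.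

Lemma rmorph_div_inj (R : comNzRingType) (F : fieldType)
    (f : {rmorphism R -> F}) a b x : injective f -> f b != 0 ->
  f x = f a / f b -> x * b = a.
Proof. by move=> injf b0 fx; apply: injf; rewrite rmorphM fx divfK. Qed.

(** K stands for the fraction field of A, and L for any field in which A[X]
    embeds. *)
Section FractionEmbedding.
Variables (A : idomainType) (n : nat) (K L : fieldType).
Local Notation B := {mpoly A[n]}.
Variables (i : {rmorphism A -> K}) (j : {rmorphism B -> L}).
Hypotheses (injj : injective j) (inji : injective i).
Hypothesis fraci : forall x, exists a b, b != 0 /\ x = i a / i b.

Let i_eq0 b : (i b == 0) = (b == 0).
Proof. by rewrite -(rmorph0 i) (inj_eq inji). Qed.

Let jC_eq0 b : (j b%:MP == 0) = (b == 0).
Proof. by rewrite -(rmorph0 j) (inj_eq injj) mpolyC_eq0. Qed.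

(* the extension to K of the inclusion of A in L: the value on a fraction does
   not depend on its representation *)
Let fracC_spec x : {y : L | forall a b, b != 0 -> x = i a / i b ->
  y = j a%:MP / j b%:MP}.
Proof.
apply: cid; have [a [b [b0 xE]]] := fraci x; exists (j a%:MP / j b%:MP).
move=> c d d0; rewrite xE => /eqP; rewrite eqr_div ?i_eq0 // -!(rmorphM i).
rewrite (inj_eq inji) => /eqP E.
by apply/eqP; rewrite eqr_div ?jC_eq0 // -!(rmorphM j) -!mpolyCM E.
Qed.

Let fracC x := sval (fracC_spec x).

Let fracCE a b : b != 0 -> fracC (i a / i b) = j a%:MP / j b%:MP.
Proof. by move=> b0; apply: (svalP (fracC_spec _)). Qed.

Let fracC_i a : fracC (i a) = j a%:MP.
Proof.
by rewrite -[i a]divr1 -(rmorph1 i) fracCE ?oner_eq0 // rmorph1 divr1.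
Qed.

Let fracC_zmod_morphism : zmod_morphism fracC.
Proof.
move=> x y; have [a [b [b0 ->]]] := fraci x; have [c [d [d0 ->]]] := fraci y.
rewrite subf_div ?i_eq0 // -!(rmorphM i) -rmorphB !fracCE ?mulf_neq0 //.
by rewrite subf_div ?jC_eq0 // -!(rmorphM j) -(rmorphB j) mpolyCB !mpolyCM.
Qed.

Let fracC_monoid_morphism : monoid_morphism fracC.
Proof.
split=> [|x y]; first by rewrite -(rmorph1 i) fracC_i rmorph1.
have [a [b [b0 ->]]] := fraci x; have [c [d [d0 ->]]] := fraci y.
rewrite mulf_div -!(rmorphM i) !fracCE ?mulf_neq0 //.
by rewrite mulf_div -!(rmorphM j) !mpolyCM.
Qed.

HB.instance Definition _ :=
  GRing.isZmodMorphism.Build K L fracC fracC_zmod_morphism.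
HB.instance Definition _ :=
  GRing.isMonoidMorphism.Build K L fracC fracC_monoid_morphism.

Local Notation toK := (map_mpoly i (n := n)).

Let clear_denominators (p : {mpoly K[n]}) :
  exists b q, b != 0 /\ i b *: p = toK q.
Proof.
rewrite (mpolyE p); elim/big_ind: _ => [|x y|m _].
- by exists 1, 0; rewrite oner_neq0 scaler0 raddf0.
- move=> [b [q [b0 Eq]]] [c [r [c0 Er]]].
  exists (b * c), (c *: q + b *: r); split; first exact: mulf_neq0.
  rewrite (raddfD (map_mpoly i)) /= !map_mpolyZ -Eq -Er !scalerA -!rmorphM.
  by rewrite scalerDr (mulrC c b).
- have [a [b [b0 ->]]] := fraci p@_m.
  exists b, (a *: 'X_[m]); split=> //.
  by rewrite map_mpolyZ map_mpolyX scalerA mulrC divfK // i_eq0.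
Qed.

(** The extension of fracC that sends each variable to itself agrees with j on
    A[X]; as every polynomial over K has a multiple by a nonzero element of A
    with coefficients in A, injectivity follows from that of j. *)
Lemma mpoly_fraction_morphism :
  exists2 f : {rmorphism {mpoly K[n]} -> L},
    injective f & forall p, f (toK p) = j p.
Proof.
pose f : {rmorphism {mpoly K[n]} -> L} := mmap fracC (fun k => j 'X_k).
have fX m : f 'X_[m] = j 'X_[m].
  rewrite /f /= mmapX /mmap1 (mpolyXE_id A) rmorph_prod.
  by apply: eq_bigr => k _; rewrite rmorphXn.
have ftoK p : f (toK p) = j p.
  rewrite (mpolyE p); elim/big_ind: _ => [|x y Ex Ey|m _].
  - by rewrite !rmorph0.
  - by rewrite !rmorphD Ex Ey.
  rewrite map_mpolyZ map_mpolyX -!mul_mpolyC (rmorphM f) (rmorphM j) fX.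
  by rewrite -fracC_i /f /= mmapC.
exists f => //; apply: raddf_inj => p p0.
have [b [q [b0 E]]] := clear_denominators p.
have q0 : q = 0.
  by apply: injj; rewrite -ftoK -E -mul_mpolyC rmorphM p0 mulr0 rmorph0.
move/eqP: E; rewrite q0 raddf0 scaler_eq0 => /orP[|/eqP//].
by rewrite i_eq0 (negPf b0).
Qed.

End FractionEmbedding.

Lemma tofrac_inj (A : idomainType) : injective (@tofrac A).
Proof. by move=> a b /eqP; rewrite tofrac_eq => /eqP. Qed.

Lemma fraction_surj (A : idomainType) (x : {fraction A}) :
  exists a b : A, b != 0 /\ x = tofrac a / tofrac b.
Proof.
exists \n_(repr x), \d_(repr x); have d0 := denom_ratioP (repr x).
split=> //; apply: (canRL (mulfK _)); first by rewrite tofrac_eq0.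
rewrite -[X in X * _]reprK; unlock tofrac; rewrite -[LHS]FracField.pi_mul.
apply/eqmodP; rewrite /= /FracField.equivf /FracField.mulf.
by rewrite !numden_Ratio ?(mulf_neq0, oner_neq0) // !mulr1 mulrC.
Qed.

(** * The polynomial overring *)

Lemma graded_domain_subring (G : zmodType) (A : idomainType)
    (Ag : G -> set A) :
  graded_domain Ag -> graded_subring setT Ag.
Proof. by case=> zA mA dA; split=> //; apply/subring_setP. Qed.

Lemma quotient_component_zmod (G : zmodType) (A : idomainType)
    (Ag : G -> set A) (g : G) :
  graded_domain Ag -> GRing.zmod_closed (mem (quotient_component Ag g)).
Proof.
case=> zA mA [dA iA]; apply/zmod_setP; split; last first.
  move=> _ _ [a [b [r [h [Ar Ah h0 -> ->]]]]]
    [a' [b' [r' [h' [Ar' Ah' h0' E ->]]]]].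
  exists (a + b'), (b + b'), (r * h' - r' * h), (h * h'); split.
  - have /zmod_setP[_ AB] := zA (a + b'); apply: AB; first exact: mA.
    have -> : a + b' = a' + b.
      by apply/eqP; rewrite -subr_eq addrAC E subrK.
    exact: mA.
  - exact: mA.
  - exact: mulf_neq0.
  - by rewrite opprD addrACA subrr addr0.
  - by rewrite subf_div ?tofrac_eq0 // tofracB !tofracM.
(* writing 0 as a fraction requires some nonzero homogeneous element: a
   component of 1 *)
have [s [f [us Af E]]] := (dA 1).1 I.
have [[h fh]|Nh] := pselect (exists h, f h != 0).
  exists (g + h), h, 0, (f h); split=> //; last by rewrite tofrac0 mul0r.
    by case/zmod_setP: (zA (g + h)).
  by rewrite addrK.
case/eqP: (oner_neq0 A); rewrite E big1 // => h _; apply/eqP.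
by apply: contrapT => /negP fh; apply: Nh; exists h.
Qed.

Section PolynomialOverring.
Variables (G : zmodType) (A : idomainType) (Ag : G -> set A) (n : nat).
Hypothesis hA : graded_domain Ag.
Local Notation K := {fraction A}.
Local Notation B := {mpoly A[n]}.
Local Notation L := {fraction B}.
Local Notation Bg := (mpoly_grading Ag (n := n)).

(** The two inclusions, of A[X] in K[X] and of K[X] in Frac(A[X]), are only
    known through these properties. *)
Variable toK : {rmorphism B -> {mpoly K[n]}}.
Hypothesis toKE : forall p m, (toK p)@_m = tofrac p@_m.
Variable phi : {rmorphism {mpoly K[n]} -> L}.
Hypotheses (phi_inj : injective phi)
  (phi_toK : forall p, phi (toK p) = tofrac p).

Lemma toK_term c m : toK (c *: 'X_[m]) = tofrac c *: 'X_[m].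
Proof.
apply/mpolyP=> k; rewrite toKE !mcoeff_term.
by case: eqP => // _; rewrite tofrac0.
Qed.

Lemma toKC c : toK c%:MP = (tofrac c)%:MP.
Proof.
by rewrite -[c%:MP]mulr1 -[(tofrac c)%:MP]mulr1 !mul_mpolyC -!mpolyX0 toK_term.
Qed.

Lemma toKX m : toK 'X_[m] = 'X_[m].
Proof. by rewrite -[X in toK X]scale1r toK_term tofrac1 scale1r. Qed.

(** The factor X^0 makes the denominator visibly homogeneous for the grading of
    A[X]. *)
Lemma phi_term r h m : h != 0 ->
  phi ((tofrac r / tofrac h) *: 'X_[m]) =
  tofrac (r *: 'X_[m]) / tofrac (h *: 'X_[0]).
Proof.
move=> h0; apply: (canRL (mulfK _)).
  by rewrite tofrac_eq0 mpolyX0 -mul_mpolyC mulr1 mpolyC_eq0.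
rewrite -!phi_toK -(rmorphM phi) !toK_term mpolyX0.
by rewrite -[in LHS]scalerAr mulr1 scalerA mulrC divfK // tofrac_eq0.
Qed.

Lemma mpoly_overT : mpoly_over setT n = [set: B].
Proof. by apply/seteqP; split. Qed.

Variable S : set K.
Hypothesis gS : graded_overring Ag S.
Local Notation Sg := (overring_component Ag S).
Local Notation SX := (mpoly_over S n).
Local Notation SXg := (mpoly_grading Sg (n := n)).

Lemma overring_graded_subring : graded_subring S Sg.
Proof.
case: gS => rS _ _ dS; split=> // g.
by apply: zmod_setI; [exact: subring_zmod|exact: quotient_component_zmod].
Qed.

Let gSX : graded_subring SX SXg.
Proof. exact: mpoly_graded_subring overring_graded_subring. Qed.

Definition mpoly_overring : set L := phi @` SX.
Local Notation T := mpoly_overring.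

(** A polynomial p with p h = r for terms r = e X^m and h = c X^k is zero or
    the term (e / c) X^(m - k), so a homogeneous fraction that happens to be a
    polynomial is homogeneous as a polynomial. *)
Lemma mpoly_overring_component d : overring_component Bg T d = phi @` SXg d.
Proof.
have zQ := quotient_component_zmod d (mpoly_graded n hA).
have zS := mpoly_grading_zmod overring_graded_subring d.
apply/seteqP; split; last first.
  move=> _ [p Dp <-]; split.
    by exists p => //; apply: (mpoly_grading_sub overring_graded_subring Dp).
  case/mpoly_gradingP: Dp => [->|].
    by rewrite raddf0; case/zmod_setP: zQ.
  case=> c [m [[Sc [a [b [r [h [Ar Ah h0 d1 ->]]]]]] d2 ->]].
  exists (a, mdegZ m), (b, mdegZ 0%MM), (r *: 'X_[m]), (h *: 'X_[0]); split.
  - exact: mpoly_grading_term.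
  - exact: mpoly_grading_term.
  - by rewrite mpolyX0 -mul_mpolyC mulr1 mpolyC_eq0.
  - case: d d1 d2 {zQ zS} => d1 d2 /= -> ->; congr pair; apply/ffunP=> i.
    by rewrite !ffunE mnm0E subr0.
  - exact: phi_term.
move=> _ [[p Sp <-] [a [b [r [h [Dr Dh h0 dE E]]]]]].
exists p => //.
have {}E : p * toK h = toK r.
  by apply: (rmorph_div_inj phi_inj); rewrite !phi_toK // tofrac_eq0.
case/mpoly_gradingP: Dh h0 E => [->|[c [k [Ac bk ->]]]]; first by rewrite eqxx.
rewrite -mul_mpolyC mulf_eq0 mpolyC_eq0 negb_or => /andP[c0 X0] E.
case/mpoly_gradingP: Dr => [r0|[e [m [Ae am re]]]].
  have -> : p = 0.
    move/eqP: E; rewrite r0 raddf0 mulf_eq0 => /orP[/eqP//|].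
    move=> /eqP/(congr1 phi); rewrite phi_toK raddf0 => /eqP.
    by rewrite tofrac_eq0 mulf_eq0 mpolyC_eq0 (negPf c0) (negPf X0).
  by case/zmod_setP: zS.
have {}E : p * (tofrac c *: 'X_[k]) = tofrac e *: 'X_[m].
  by move: E; rewrite re mul_mpolyC !toK_term.
have pE j : p@_j = if m == (k + j)%MM then tofrac e / tofrac c else 0.
  have := congr1 (mcoeff (k + j)) E.
  rewrite -scalerAr mcoeffZ mcoeffMX mcoeff_term mulrC => Ej.
  have tc0 : tofrac c != 0 by rewrite tofrac_eq0.
  by rewrite -[LHS](mulfK tc0) Ej; case: eqP => // _; rewrite mul0r.
have [km|km] := boolP (k <= m)%MM; last first.
  have -> : p = 0.
    apply/mpolyP=> j; rewrite pE mcoeff0; case: eqP => // mE.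
    by case/negP: km; rewrite mE lem_addr.
  by case/zmod_setP: zS.
apply/mpoly_gradingP; right; exists (tofrac e / tofrac c), (m - k)%MM; split.
- split; first by have := Sp (m - k)%MM; rewrite pE addmC submK // eqxx.
  by exists a.1, b.1, e, c; split=> //; rewrite dE.
- rewrite dE /= am bk; apply/ffunP=> i; rewrite !ffunE mnmBE.
  by rewrite -subzn //; move/mnm_lepP: km.
- apply/mpolyP=> j; rewrite pE mcoeff_term.
  congr (if _ then _ else _); apply/eqP/eqP => [->|<-]; last first.
    by rewrite addmC submK.
  by rewrite addmC addmK.
Qed.

Lemma mpoly_overring_grading :
  overring_component Bg T = (fun d => phi @` SXg d).
Proof. by apply/funext=> d; apply: mpoly_overring_component. Qed.

Lemma mpoly_overring_graded_overring : graded_overring Bg T.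
Proof.
have [rT zT dT] := graded_subring_image phi_inj gSX.
have [rS AS SH _] := gS.
split=> //; last by rewrite mpoly_overring_grading.
  move=> p; exists (toK p); last exact: phi_toK.
  by move=> m; rewrite toKE; apply: AS.
have HD x y : graded_quotient_field Bg x -> graded_quotient_field Bg y ->
    graded_quotient_field Bg (x + y).
  move=> [r [h [[h0 [a Dh]] ->]]] [r' [h' [[h0' [b Dh']] ->]]].
  exists (r * h' + r' * h), (h * h'); split.
    split; first exact: mulf_neq0.
    exists (a + b); have [_ mB _] := mpoly_graded n hA.
    exact: mB.
  by rewrite addf_div ?tofrac_eq0 // tofracD !tofracM.
have Hterm c m : S c -> graded_quotient_field Bg (phi (c *: 'X_[m])).
  move=> /SH[r [h [[h0 [a Ah]] ->]]].
  exists (r *: 'X_[m]), (h *: 'X_[0]); split.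
    split; last by exists (a, mdegZ 0%MM); apply: mpoly_grading_term.
    by rewrite mpolyX0 -mul_mpolyC mulr1 mpolyC_eq0.
  exact: phi_term.
have S0 : S 0 by case/zmod_setP: (subring_zmod rS).
move=> _ [p Sp <-]; rewrite (mpolyE p) raddf_sum.
elim/big_ind: _ => // [|m _]; last exact: Hterm.
by have := Hterm 0 0%MM S0; rewrite scale0r raddf0.
Qed.

Lemma mpoly_overring_gr_local :
  gr_local S Sg -> gr_local T (overring_component Bg T).
Proof.
move=> lS; rewrite mpoly_overring_grading.
apply: (gr_local_image phi_inj gSX).
exact: (gr_local_mpoly n overring_graded_subring).
Qed.

(** The prime over P is found as the extension, by the variables in P, of the
    prime of S that going down provides over the constants of P. *)
Lemma mpoly_overring_gGD : gGD Ag S -> gGD Bg T.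
Proof.
move=> gdS P Q Qt hP hQ hQt PQ QtQ.
have gA := graded_domain_subring hA.
have gS' := overring_graded_subring.
rewrite mpoly_overring_grading in hQt *.
have [N NS QtE] : exists2 N, N `<=` SX & Qt = phi @` N.
  by apply: image_of_subset; case: hQt => -[].
rewrite {}QtE in hQt QtQ *.
have {hQt}hN := (hSpec_image phi_inj gSX N).1 hQt.
have QE p : Q p <-> N (toK p).
  by rewrite -QtQ /preimage /= -(image_fE phi_inj N) phi_toK.
rewrite -mpoly_overT in hP hQ.
have := gdS _ _ _ (contraction_hSpec gA hP) (contraction_hSpec gA hQ)
  (contraction_hSpec gS' hN).
case=> [c /PQ //||M [hM MN MP]].
  apply/predeqP=> c; rewrite /preimage /= -toKC.
  by split=> /QE.
have MPE c : M (tofrac c) = P c%:MP := congr1 (fun I : set A => I c) MP.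
pose V : set 'I_n := [set i | P 'X_i].
exists (phi @` monomial_extension S M V); split.
- apply/(hSpec_image phi_inj gSX).
  exact: (extension_hSpec gS').
- apply: image_subset; rewrite (hSpec_mpolyE gS' hN) => p [Sp Mp].
  split=> // m mV; apply: MN; apply: Mp => i Pi; apply: mV.
  by have /QE := PQ _ Pi; rewrite toKX.
- rewrite [RHS](hSpec_mpolyE gA hP); apply/seteqP; split=> p.
    rewrite /preimage /= -phi_toK => -[q [Sq Mq] /phi_inj qE].
    split=> // m mV; rewrite /preimage /= -MPE -toKE -qE.
    exact: Mq.
  move=> [_ Pp]; exists (toK p); last exact: phi_toK.
  have [_ AS _ _] := gS.
  split=> m => [|mV]; rewrite toKE; first exact: AS.
  by rewrite MPE; apply: Pp.
Qed.

(** The elements of W have inverses in T, hence are units of K[X], that is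
    constants: the localization only inverts elements of A. *)
Lemma mpoly_overring_localization (W : set B) :
  Defs.multiplicative W -> T = localization W ->
  Defs.multiplicative (mpolyC n (R := A) @^-1` W) /\
  S = localization (mpolyC n (R := A) @^-1` W).
Proof.
move=> [W1 WM W0] TW; split.
  split; rewrite /preimage /= ?mpolyC1 ?mpolyC0 //.
  by move=> x y Wx Wy /=; rewrite mpolyCM; apply: WM.
have Wunit w : W w -> exists2 v, toK w * v = 1 & w = (w@_0)%:MP.
  move=> Ww; have w0 : w != 0 by apply/eqP=> w0; apply: W0; rewrite -w0.
  have [v _ vE] : T (1 / tofrac w).
    by rewrite TW; exists 1, w; rewrite tofrac1.
  have wv : toK w * v = 1.
    apply: phi_inj.
    by rewrite (rmorphM phi) vE phi_toK rmorph1 mulrC divfK // tofrac_eq0.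
  exists v => //; apply/mpolyP=> m.
  have : toK w \is a GRing.unit by apply/unitrP; exists v; rewrite mulrC wv.
  case/andP=> /eqP wC _; apply/eqP; rewrite -tofrac_eq -!toKE.
  by rewrite toKC {1}wC !toKE.
apply/predeqP=> s; split=> [Ss|[r [w [Ww ->]]]].
  have : T (phi s%:MP).
    by exists s%:MP => //; apply: (mpoly_overC overring_graded_subring).
  rewrite TW => -[r [w [Ww sE]]].
  have [_ _ wC] := Wunit w Ww.
  have w0 : w != 0 by apply/eqP=> w0; apply: W0; rewrite -w0.
  have wc0 : w@_0 != 0 by rewrite wC mpolyC_eq0 in w0.
  exists r@_0, w@_0; split; first by rewrite /preimage /= -wC.
  have E : s%:MP * toK w = toK r.
    apply: phi_inj.
    by rewrite (rmorphM phi) sE !phi_toK divfK // tofrac_eq0.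
  have := congr1 (mcoeff 0%MM) E; rewrite mcoeffCM !toKE => <-.
  by rewrite mulfK // tofrac_eq0.
have w0 : w != 0 by apply/eqP=> w0; apply: W0; rewrite /preimage /= w0 in Ww.
have [p Sp pE] : T (phi (tofrac r / tofrac w)%:MP).
  rewrite TW -[(_ / _)%:MP]mulr1 mul_mpolyC -mpolyX0 phi_term //.
  by exists r%:MP, w%:MP; rewrite -!mul_mpolyC mpolyX0 !mulr1.
have := Sp 0%MM; rewrite (phi_inj pE).
by rewrite mcoeffC eqxx mulr1.
Qed.

End PolynomialOverring.

Theorem corollary2p36 (G : zmodType) (hG : torsion_free G) (A : idomainType)
    (Ag : G -> set A) (hA : graded_domain Ag) (n : nat) :
  graded_perinormal (mpoly_grading Ag (n := n)) -> graded_perinormal Ag.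
Proof.
move=> pB S gS lS gdS.
pose toK : {rmorphism {mpoly A[n]} -> {mpoly {fraction A}[n]}} :=
  map_mpoly (@tofrac A).
have toKE p m : (toK p)@_m = tofrac p@_m by apply: mcoeff_map_mpoly.
have [phi phi_inj phi_toK] :=
  mpoly_fraction_morphism (@tofrac_inj {mpoly A[n]}) (@tofrac_inj A)
    (@fraction_surj A).
have [W [mW TW]] := pB _
  (mpoly_overring_graded_overring hA toKE phi_inj phi_toK gS)
  (mpoly_overring_gr_local hA toKE phi_inj phi_toK gS lS)
  (mpoly_overring_gGD hA toKE phi_inj phi_toK gS gdS).
exists (mpolyC n (R := A) @^-1` W).
exact: (mpoly_overring_localization hA toKE phi_inj phi_toK gS mW TW).
Qed.
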